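(* There is an algorithm that, given a finite-state automaton $\mathcal{S}=(X,T,X_0,\to,\Sigma,\ell)$, a specification $X_{\mathrm{spec}}\subset X\times X$, and $k_1,k_2\in\mathbb{N}$, decides in polynomial time (polynomial in the size of $\mathcal{S}$ and in $k_1,k_2$) whether $\mathcal{S}$ is $*$-$(k_1,k_2)$-D-detectable with respect to $X_{\mathrm{spec}}$.
   Context: A finite-state automaton (FSA) is a sextuple $\mathcal{S}=(X,T,X_0,\to,\Sigma,\ell)$, where $X$ is a finite set of states, $T$ a finite set of events, $X_0\subset X$ a set of initial states, $\to\subset X\times T\times X$ a transition relation, $\Sigma$ a finite set of labels, and $\ell:T\to\Sigma\cup\{\epsilon\}$ a labeling function ($\epsilon$ is the empty word). No further assumption (deadlock-freeness, absence of unobservable cycles, etc.) is made. $\ell$ is extended to finite event sequences by $\ell(t_1\cdots t_n)=\ell(t_1)\cdots\ell(t_n)$, $\ell(\epsilon)=\epsilon$. For $s=t_1\cdots t_n\in T^*$, $x\xrightarrow{s}x'$ means that there are states $x=x_0,x_1,\dots,x_n=x'$ with $(x_{i-1},t_i,x_i)\in\to$ for all $i$ (so $x\xrightarrow{\epsilon}x$). The size of $\mathcal{S}$ is e.g. $|X|+|T|+|\Sigma|+|\to|$. For $\sigma_1,\sigma_2\in\Sigma^*$ define the delayed state estimate $$\mathcal{M}(\mathcal{S},\sigma_1,\sigma_2)=\{x\in X\mid \exists x_0\in X_0,\ \exists x'\in X,\ \exists s_1,s_2\in T^*:\ \ell(s_1)=\sigma_1,\ \ell(s_2)=\sigma_2,\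 x_0\xrightarrow{s_1}x\xrightarrow{s_2}x'\}.$$ The language $\mathcal{L}(\mathcal{S})$ is the set of $\sigma\in\Sigma^*$ such that $x_0\xrightarrow{s}x$ for some $x_0\in X_0$, $x\in X$, $s\in T^*$ with $\ell(s)=\sigma$. Write $\sigma'\sqsubset\sigma$ if the finite word $\sigma'$ is a prefix of $\sigma$ (possibly equal to $\sigma$). $\mathcal{S}$ is $*$-$(k_1,k_2)$-D-detectable with respect to $X_{\mathrm{spec}}\subset X\times X$ if for all $\sigma\in\mathcal{L}(\mathcal{S})$ and all $\sigma_1,\sigma_2\in\Sigma^*$ with $\sigma_1\sigma_2\sqsubset\sigma$: if $|\sigma_1|\ge k_1$ and $|\sigma_2|\ge k_2$, then $(\mathcal{M}(\mathcal{S},\sigma_1,\sigma_2)\times\mathcal{M}(\mathcal{S},\sigma_1,\sigma_2))\cap X_{\mathrm{spec}}=\emptyset$. *)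

(* Defs.v *)
From mathcomp Require Import all_boot all_algebra.
From mathcomp Require Import boolp classical_sets.

Set Implicit Arguments.
Unset Strict Implicit.
Unset Printing Implicit Defensive.

Record fsa := Fsa {
  state : finType;
  event : finType;
  label : finType;
  init : {set state};
  trans : {set state * event * state};
  lab : event -> option label (* [None] is the empty word *)
}.

Section Automaton.
Variable S : fsa.

Definition labs (s : seq (event S)) : seq (label S) := pmap (@lab S) s.

Fixpoint fsa_run (x : state S) (s : seq (event S)) (x' : state S) : Prop :=
  if s is t :: s' then exists2 y, (x, t, y) \in trans S & fsa_run y s' x'
  else x = x'.

Definition language : set (seq (label S)) :=
  [set w | exists x0 x s, [/\ x0 \in init S, labs s = w & fsa_run x0 s x]]%classic.

Definition delayed_estimate (w1 w2 : seq (label S)) : set (state S) :=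
  [set x | exists x0 x' s1 s2,
    [/\ x0 \in init S, labs s1 = w1, labs s2 = w2,
        fsa_run x0 s1 x & fsa_run x s2 x']]%classic.

Definition star_D_detectable (Xspec : {set state S * state S}) (k1 k2 : nat) :=
  forall w, language w -> forall w1 w2, prefix (w1 ++ w2) w ->
    k1 <= size w1 -> k2 <= size w2 ->
    ((delayed_estimate w1 w2 `*` delayed_estimate w1 w2)
       `&` [set` Xspec] = set0)%classic.

Definition fsa_size : nat :=
  #|state S| + #|event S| + #|label S| + #|trans S|.

(* Elements of a finite type are represented by their ranks. The unobservable
   label is the number 0 and the label of rank i is the number i + 1. *)
Definition lab_code (t : event S) : nat :=
  if lab t is Some a then (enum_rank a).+1 else 0.

Definition trans_code (e : state S * event S * state S) : seq nat :=
  [:: enum_rank e.1.1 : nat; enum_rank e.1.2 : nat; enum_rank e.2 : nat].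

Definition spec_code (e : state S * state S) : seq nat :=
  [:: enum_rank e.1 : nat; enum_rank e.2 : nat].

Definition instance_code (Xspec : {set state S * state S}) (k1 k2 : nat) :
    seq nat :=
  [:: #|state S|; #|event S|; #|label S|; #|init S|; #|trans S|; #|Xspec|;
      k1; k2]
  ++ [seq enum_rank x : nat | x <- enum (init S)]
  ++ [seq lab_code t | t <- enum (event S)]
  ++ flatten [seq trans_code e | e <- enum (trans S)]
  ++ flatten [seq spec_code e | e <- enum Xspec].

End Automaton.

(* Random access machines in the style of Cook and Reckhow: registers r_0, r_1,
   r_2, ... hold natural numbers, and the input is a read-only sequence of
   natural numbers. As addition and subtraction are the only arithmetic
   operations, a run of t steps produces numbers having at most t more bits than
   the largest input entry or program constant. Counting one unit of time per
   instruction is therefore polynomially equivalent to Turing machine time. *)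
Inductive instr :=
| IConst of nat & nat       (* IConst i c   : r_i := c *)
| IAdd of nat & nat & nat   (* IAdd i j k   : r_i := r_j + r_k *)
| ISub of nat & nat & nat   (* ISub i j k   : r_i := r_j - r_k, truncated at 0 *)
| ILoad of nat & nat        (* ILoad i j    : r_i := r_(r_j) *)
| IStore of nat & nat       (* IStore i j   : r_(r_i) := r_j *)
| IRead of nat & nat        (* IRead i j    : r_i := input entry number r_j,
                                              0 past the end *)
| IJumpPos of nat & nat.    (* IJumpPos j l : if r_j > 0 then go to line l *)

Definition program := seq instr.

Record config := Config { pc : nat; reg : nat -> nat }.

Definition upd (r : nat -> nat) (i v : nat) : nat -> nat :=
  fun j => if j == i then v else r j.

Definition exec (input : seq nat) (c : config) (ins : instr) : config :=
  let n := pc c in let r := reg c in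
  match ins with
  | IConst i v => Config n.+1 (upd r i v)
  | IAdd i j k => Config n.+1 (upd r i (r j + r k))
  | ISub i j k => Config n.+1 (upd r i (r j - r k))
  | ILoad i j => Config n.+1 (upd r i (r (r j)))
  | IStore i j => Config n.+1 (upd r (r i) (r j))
  | IRead i j => Config n.+1 (upd r i (nth 0 input (r j)))
  | IJumpPos j l => Config (if 0 < r j then l else n.+1) r
  end.

Definition halted (prog : program) (c : config) : bool := size prog <= pc c.

Definition step (prog : program) (input : seq nat) (c : config) : config :=
  if onth prog (pc c) is Some ins then exec input c ins else c.

Definition run_for (prog : program) (input : seq nat) (t : nat) : config :=
  iter t (step prog input) (Config 0 (fun=> 0)).

(* The answer of a halted machine is "yes" exactly when r_0 is nonzero. *)
Definition decides_within (prog : program) (input : seq nat) (bound : nat)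
    (Q : Prop) : Prop :=
  exists t, [/\ t <= bound, halted prog (run_for prog input t) &
                0 < reg (run_for prog input t) 0 <-> Q].

(* Main.v *)
Require Import Defs.
From mathcomp Require Import all_boot all_algebra.
From mathcomp Require Import zify.
From mathcomp Require Import boolp classical_sets.

(* Detectability fails exactly when a pair of Xspec is reached from two initial
   states by equally labelled runs with at least k1 observations and can be left
   by equally labelled runs with at least k2 observations. For every pair of
   states a table records the furthest stage, from 0 (unreached) to
   k1 + k2 + 2 (violation), that is known to be attained there; keeping only the
   maximum is enough because a pair at a later stage can do whatever it could do
   at an earlier one. Stages are propagated along pairs of equally labelled
   transitions. Each round that changes something increases the sum of the
   table, so with n states n ^ 2 * (k1 + k2 + 2) rounds reach a fixed point.
   The program only has counted loops, each with a polynomially bounded number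
   of iterations fixed on entry, so that its running time is a polynomial read
   off its syntax. *)

Set Implicit Arguments.
Unset Strict Implicit.
Unset Printing Implicit Defensive.

(** * Programs with counted loops and their compilation *)

Inductive cmd :=
| CConst of nat & nat
| CAdd of nat & nat & nat
| CSub of nat & nat & nat
| CRead of nat & nat
| CLoad of nat & nat
| CStore of nat & nat
| CSeq of cmd & cmd
| CUnless of nat & cmd
| CFor of nat & nat & cmd.

Notation "c ;; d" := (CSeq c d) (at level 61, right associativity).

(** Scalars and table cells are kept apart, so that a store at a computed address cannot overwrite a
    loop counter or a constant of the run. *)
Record store := Store { sc : nat -> nat; tb : nat -> nat }.

Definition setr (h : store) i v := Store (upd (sc h) i v) (tb h).
Definition sett (h : store) a v := Store (sc h) (upd (tb h) a v).

Fixpoint eval (inp : seq nat) (c : cmd) (h : store) : store :=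
  match c with
  | CConst i v => setr h i v
  | CAdd i j k => setr h i (sc h j + sc h k)
  | CSub i j k => setr h i (sc h j - sc h k)
  | CRead i j => setr h i (nth 0 inp (sc h j))
  | CLoad i j => setr h i (tb h (sc h j))
  | CStore i j => sett h (sc h i) (sc h j)
  | CSeq c d => eval inp d (eval inp c h)
  | CUnless r c => if 0 < sc h r then h else eval inp c h
  | CFor i n c =>
      iter (sc h n) (fun h' => setr (eval inp c h') i (sc (eval inp c h') i).+1)
           (setr h i 0)
  end.

(* Register 1 is the scratch register of compiled code; table cell number a
   is register 40 + a. *)
Definition tbase := 40.
Definition rok i := (i < tbase) && (i != 1).

Fixpoint csize (c : cmd) : nat :=
  match c with
  | CLoad _ _ | CStore _ _ => 3
  | CSeq c d => csize c + csize d
  | CUnless _ c => (csize c).+1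
  | CFor _ _ c => 7 + csize c
  | _ => 1
  end.

(** Jump targets are absolute, hence the offset [o]. A loop is entered at its test, past the
    increment, so that a zero bound skips the body. Setting register 1 to one makes this conditional
    jump unconditional. *)
Fixpoint compile (o : nat) (c : cmd) : program :=
  match c with
  | CConst i v => [:: IConst i v]
  | CAdd i j k => [:: IAdd i j k]
  | CSub i j k => [:: ISub i j k]
  | CRead i j => [:: IRead i j]
  | CLoad i j => [:: IConst 1 tbase; IAdd 1 1 j; ILoad i 1]
  | CStore i j => [:: IConst 1 tbase; IAdd 1 1 i; IStore 1 j]
  | CSeq c d => compile o c ++ compile (o + csize c) d
  | CUnless r c => IJumpPos r (o + (csize c).+1) :: compile o.+1 c
  | CFor i n c =>
      [:: IConst i 0; IConst 1 1; IJumpPos 1 (o + (5 + csize c))]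
      ++ compile (o + 3) c
      ++ [:: IConst 1 1; IAdd i i 1; ISub 1 n i; IJumpPos 1 (o + 3)]
  end.

Fixpoint wr (c : cmd) : seq nat :=
  match c with
  | CConst i _ | CAdd i _ _ | CSub i _ _ | CRead i _ | CLoad i _ => [:: i]
  | CStore _ _ => [::]
  | CSeq c d => wr c ++ wr d
  | CUnless _ c => wr c
  | CFor i _ c => i :: wr c
  end.

Fixpoint bnds (c : cmd) : seq nat :=
  match c with
  | CSeq c d => bnds c ++ bnds d
  | CUnless _ c => bnds c
  | CFor _ n c => n :: bnds c
  | _ => [::]
  end.

(** Compiled loops read their bound again at every test, whereas [eval] reads it once on entry. The
    conditions on [CFor] make the two counts agree. *)
Fixpoint wf (c : cmd) : bool :=
  match c with
  | CConst i _ => rok i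
  | CAdd i j k | CSub i j k => [&& rok i, rok j & rok k]
  | CRead i j | CLoad i j | CStore i j => rok i && rok j
  | CSeq c d => wf c && wf d
  | CUnless r c => rok r && wf c
  | CFor i n c => [&& rok i, rok n, i != n, i \notin wr c, n \notin wr c & wf c]
  end.

(** The indeterminate stands for a common bound on all iteration counts. A loop spends 3 steps on
    entry, 2 on the last test, and 4 per turn besides its body. *)
Fixpoint costp (c : cmd) : {poly nat} :=
  (match c with
  | CLoad _ _ | CStore _ _ => 3%:P
  | CSeq c d => costp c + costp d
  | CUnless _ c => 1%:P + costp c
  | CFor _ _ c => 5%:P + 'X * (costp c + 4%:P)
  | _ => 1%:P
  end)%R.

Lemma size_compile o c : size (compile o c) = csize c.
Proof.
elim: c o => //= [c IHc d IHd|r c IHc|i n c IHc] o.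
- by rewrite size_cat IHc IHd.
- by rewrite IHc.
- by rewrite size_cat IHc /=; lia.
Qed.

Lemma eval_sc inp c h r : r \notin wr c -> sc (eval inp c h) r = sc h r.
Proof.
elim: c h => //=.
- by move=> i v h; rewrite inE /upd => /negbTE ->.
- by move=> i j k h; rewrite inE /upd => /negbTE ->.
- by move=> i j k h; rewrite inE /upd => /negbTE ->.
- by move=> i j h; rewrite inE /upd => /negbTE ->.
- by move=> i j h; rewrite inE /upd => /negbTE ->.
- by move=> c IHc d IHd h; rewrite mem_cat negb_or => /andP[rc rd];
    rewrite IHd // IHc.
- by move=> s c IHc h rc; case: ifP => // _; exact: IHc.
- move=> i n c IHc h; rewrite inE negb_or => /andP[ri rc].
  elim: (sc h n) => [|k IHk] /=; first by rewrite /upd (negbTE ri).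
  by rewrite {1}/upd (negbTE ri) IHc.
Qed.

Fixpoint nost (c : cmd) : bool :=
  match c with
  | CStore _ _ => false
  | CSeq c d => nost c && nost d
  | CUnless _ c | CFor _ _ c => nost c
  | _ => true
  end.

Lemma eval_tb inp c h : nost c -> tb (eval inp c h) = tb h.
Proof.
elim: c h => //= [c IHc d IHd|s c IHc|i n c IHc] h.
- by case/andP=> nc nd; rewrite IHd // IHc.
- by move=> nc; case: ifP => // _; exact: IHc.
- by move=> nc; elim: (sc h n) => [|k IHk] //=; rewrite IHc.
Qed.

Lemma eval_for_sc inp i c h k :
  i \notin wr c ->
  sc (iter k (fun h' => setr (eval inp c h') i (sc (eval inp c h') i).+1)
           (setr h i 0)) i = k.
Proof.
move=> ic; elim: k => [|k IHk] /=; first by rewrite /upd eqxx.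
by rewrite /upd eqxx eval_sc ?IHk.
Qed.

Section Compile.
Variables (prog : program) (inp : seq nat).

Definition agree (r : nat -> nat) (h : store) :=
  forall k, k != 1 -> r k = if k < tbase then sc h k else tb h (k - tbase).

Definition placed (o : nat) (s : program) :=
  forall k, k < size s -> onth prog (o + k) = onth s k.

Lemma placed_cat o s1 s2 :
  placed o (s1 ++ s2) -> placed o s1 /\ placed (o + size s1) s2.
Proof.
move=> H; split=> k lk.
  rewrite H ?size_cat; last by lia.
  by rewrite onth_cat lk.
rewrite -addnA H ?size_cat; last by lia.
by rewrite onth_cat ltnNge leq_addr /= addKn.
Qed.

Definition runs (o : nat) (c : cmd) (T : nat) (h h' : store) :=
  forall r, agree r h -> exists t r',
    [/\ t <= T, iter t (step prog inp) (Config o r) = Config (o + csize c) r'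
      & agree r' h'].

Lemma agree_upd r h i v : rok i -> agree r h -> agree (upd r i v) (setr h i v).
Proof.
case/andP=> li i1 H k k1; rewrite /= /upd; case: (k =P i) => [->|_]; last by rewrite H.
by rewrite li.
Qed.

Lemma agree_upd1 r h v : agree r h -> agree (upd r 1 v) h.
Proof. by move=> H k k1; rewrite -H // /upd (negbTE k1). Qed.

Lemma agree_updt r h a v : agree r h -> agree (upd r (tbase + a) v) (sett h a v).
Proof.
move=> H k k1; rewrite /= /upd; case: (k =P tbase + a) => [->|kt].
  by rewrite ltnNge leq_addr /= addKn eqxx.
rewrite H //; case: ltnP => // lk; case: (k - tbase =P a) => // ak; case: kt; lia.
Qed.

Lemma agree_sc r h i : rok i -> agree r h -> r i = sc h i.
Proof. by case/andP=> li i1 H; rewrite H // li. Qed.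

Lemma step_at o r i :
  onth prog o = Some i -> step prog inp (Config o r) = exec inp (Config o r) i.
Proof. by rewrite /step /= => ->. Qed.

Lemma runs_seq o c d T T' h h' h'' :
  runs o c T h h' -> runs (o + csize c) d T' h' h'' ->
  runs o (c ;; d) (T + T') h h''.
Proof.
move=> Hc Hd r /Hc[t [r1 [lt e1 /Hd[t' [r2 [lt' e2 a2]]]]]].
exists (t' + t), r2; split=> //; first by lia.
by rewrite iterD e1 e2 /= addnA.
Qed.

(** As no loop bound is ever written, the bounds of inner loops still have their initial values when
    those loops are entered, so a hypothesis on the initial store limits every iteration count. *)
Lemma compile_ok c (M : nat) h o :
  wf c -> all (fun n => n \notin wr c) (bnds c) ->
  (forall n, n \in bnds c -> sc h n <= M) ->
  placed o (compile o c) -> runs o c (costp c).[M]%R h (eval inp c h).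
Proof.
elim: c h o => /=.
- move=> i v h o wi _ _ /(_ 0 isT) /=; rewrite addn0 => Ho r ar.
  exists 1, (upd r i v); split; first by rewrite hornerC.
    by rewrite /= (step_at _ Ho) /= addn1.
  exact: agree_upd.
- move=> i j k h o /and3P[wi wj wk] _ _ /(_ 0 isT) /=; rewrite addn0 => Ho r ar.
  exists 1, (upd r i (r j + r k)); split; first by rewrite hornerC.
    by rewrite /= (step_at _ Ho) /= addn1.
  by rewrite (agree_sc wj ar) (agree_sc wk ar); exact: agree_upd.
- move=> i j k h o /and3P[wi wj wk] _ _ /(_ 0 isT) /=; rewrite addn0 => Ho r ar.
  exists 1, (upd r i (r j - r k)); split; first by rewrite hornerC.
    by rewrite /= (step_at _ Ho) /= addn1.
  by rewrite (agree_sc wj ar) (agree_sc wk ar); exact: agree_upd.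
- move=> i j h o /andP[wi wj] _ _ /(_ 0 isT) /=; rewrite addn0 => Ho r ar.
  exists 1, (upd r i (nth 0 inp (r j))); split; first by rewrite hornerC.
    by rewrite /= (step_at _ Ho) /= addn1.
  by rewrite (agree_sc wj ar); exact: agree_upd.
- move=> i j h o /andP[wi wj] _ _ Hp r ar.
  have := Hp 0 isT; have := Hp 1 isT; have := Hp 2 isT.
  rewrite /= addn0 addn1 addn2 => H2 H1 H0.
  have j1 : (j == 1) = false by apply/negbTE; case/andP: wj.
  exists 3, (upd (upd (upd r 1 tbase) 1 (tbase + r j)) i (r (tbase + r j))).
  split; first by rewrite hornerC.
    rewrite /= (step_at _ H0) /= (step_at _ H1) /= (step_at _ H2) /= addn3.
    by rewrite /upd /= j1.
  rewrite (ar (tbase + r j)) // ltnNge leq_addr /= addKn (agree_sc wj ar).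
  by do ![apply: agree_upd1 | apply: agree_upd].
- move=> i j h o /andP[wi wj] _ _ Hp r ar.
  have := Hp 0 isT; have := Hp 1 isT; have := Hp 2 isT.
  rewrite /= addn0 addn1 addn2 => H2 H1 H0.
  have i1 : (i == 1) = false by apply/negbTE; case/andP: wi.
  have j1 : (j == 1) = false by apply/negbTE; case/andP: wj.
  exists 3, (upd (upd (upd r 1 tbase) 1 (tbase + r i)) (tbase + r i) (r j)).
  split; first by rewrite hornerC.
    rewrite /= (step_at _ H0) /= (step_at _ H1) /= (step_at _ H2) /= addn3.
    by rewrite /upd /= i1 j1.
  rewrite (agree_sc wi ar) (agree_sc wj ar).
  by apply: agree_updt; do 2 apply: agree_upd1.
- move=> c IHc d IHd h o /andP[wc wd]; rewrite all_cat => /andP[bc bd] HM.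
  case/placed_cat; rewrite size_compile => pc pd.
  have sub (s : seq nat) e e' : all (fun n => n \notin wr e ++ wr e') s ->
      all (fun n => n \notin wr e) s /\ all (fun n => n \notin wr e') s.
    by move=> /allP H; split; apply/allP => n /H; rewrite mem_cat negb_or; case/andP.
  have [bcc _] := sub _ _ _ bc; have [bdc bdd] := sub _ _ _ bd.
  rewrite hornerD; apply: runs_seq (IHc _ _ wc bcc _ pc) _.
    by move=> n nc; apply: HM; rewrite mem_cat nc.
  apply: IHd => // n nd; rewrite eval_sc; last exact: (allP bdc).
  by apply: HM; rewrite mem_cat nd orbT.
- move=> s c IHc h o /andP[ws wc] bc HM Hp r ar.
  have Ho : onth prog o = Some (IJumpPos s (o + (csize c).+1)).
    by have := Hp 0 isT; rewrite addn0.
  have pc : placed o.+1 (compile o.+1 c).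
    by move=> k lk; have := Hp k.+1 lk; rewrite addnS addSn.
  rewrite hornerD hornerC; case: ltnP => hs.
    exists 1, r; split=> //.
    by rewrite /= (step_at _ Ho) /= (agree_sc ws ar) hs.
  have [t [r' [lt e ar']]] := IHc h o.+1 wc bc HM pc r ar.
  exists (t + 1), r'; split=> //; first by rewrite addnC leq_add2l.
  rewrite iterD /= (step_at _ Ho) /= (agree_sc ws ar) ltnNge hs /= e.
  by rewrite addnS addSn.
- move=> i n c IHc h o /and5P[wi wn ni iw /andP[nw wc]] /= /andP[_ bc] HM Hp r ar.
  have [H1 /= H23] := placed_cat (s1 := [:: _; _; _]) Hp.
  have := placed_cat H23; rewrite size_compile => -[pc H3] {H23 Hp}.
  have := H1 0 isT; have := H1 1 isT; have := H1 2 isT => /=.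
  rewrite addn0 addn1 addn2 => I2 I1 I0.
  have := H3 0 isT; have := H3 1 isT; have := H3 2 isT; have := H3 3 isT => /=.
  rewrite addn0 addn1 addn2 addn3; set p := o + 3 + csize c => J3 J2 J1 J0 {H1 H3}.
  have Ep : o + (5 + csize c) = p.+2 by rewrite /p; lia.
  have i1 : (i == 1) = false by apply/negbTE; case/andP: wi.
  have n1 : (n == 1) = false by apply/negbTE; case/andP: wn.
  pose F h' := setr (eval inp c h') i (sc (eval inp c h') i).+1.
  pose hk k := iter k F (setr h i 0).
  have hki k : sc (hk k) i = k by exact: eval_for_sc.
  have hkn k b : b != i -> b \notin wr c -> sc (hk k) b = sc h b.
    move=> bi bw; elim: k => [|k IHk] /=; first by rewrite /upd (negbTE bi).
    by rewrite {1}/upd (negbTE bi) eval_sc.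
  have /= bc' : forall b, b \in bnds c -> (b != i) && (b \notin wr c).
    by move=> b /(allP bc); rewrite inE negb_or.
  set D := (costp c).[M]%R.
  (* Invariant at the loop test, line [p.+2], after [k] turns. *)
  have loop k : k <= sc h n -> exists t r',
     [/\ t <= 3 + k * (D + 4),
         iter t (step prog inp) (Config o r) = Config p.+2 r' & agree r' (hk k)].
    elim: k => [_|k IHk lk].
      exists 3, (upd (upd r i 0) 1 1); split=> //.
        rewrite /= (step_at _ I0) /= (step_at _ I1) /= (step_at _ I2) /=.
        by rewrite Ep {1}/upd.
      by apply: agree_upd1; apply: agree_upd.
    have [t [r1 [lt e1 a1]]] := IHk (ltnW lk).
    have bk : forall b, b \in bnds c -> sc (hk k) b <= M.
      by move=> b bb; case/andP: (bc' _ bb) => *; rewrite hkn // HM // inE bb orbT.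
    have ba : all (fun b => b \notin wr c) (bnds c).
      by apply/allP => b /bc' /andP[].
    have [t2 [r2 [lt2 e2 a2]]] := IHc _ _ wc ba bk pc _ (agree_upd1 (r1 n - r1 i) a1).
    exists (2 + (t2 + (2 + t))), (upd (upd r2 1 1) i (r2 i + 1)); split.
    - by rewrite mulSn; move: lt lt2; rewrite -/D; lia.
    - rewrite iterD (iterD t2) (iterD 2 t) e1 /= (step_at _ J2) /= (step_at _ J3) /=.
      rewrite {1}/upd /= (agree_sc wn a1) (agree_sc wi a1) hki hkn //; last first.
        by rewrite eq_sym.
      rewrite subn_gt0 lk; move: e2; rewrite (agree_sc wn a1) (agree_sc wi a1) hki hkn //;
        last by rewrite eq_sym.
      move=> ->; rewrite -/p (step_at _ J0) /= (step_at _ J1) /=.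
      by rewrite /upd /= i1.
    - rewrite /hk /= -/(hk k) /F (agree_sc wi a2) addn1.
      by apply: agree_upd => //; apply: agree_upd1.
  have [t [r1 [lt e1 a1]]] := loop _ (leqnn _).
  exists (2 + t), (upd r1 1 (r1 n - r1 i)); split.
  - rewrite hornerD hornerC hornerM hornerX hornerD hornerC -/D.
    have := HM n; rewrite inE eqxx => /(_ isT) Hn.
    have : sc h n * (D + 4) <= M * (D + 4) by rewrite leq_mul2r Hn orbT.
    by move: lt; rewrite /GRing.add /GRing.mul /=; lia.
  - rewrite iterD e1 /= (step_at _ J2) /= (step_at _ J3) /= {1}/upd /=.
    rewrite (agree_sc wn a1) (agree_sc wi a1) hki hkn 1?eq_sym // subnn /=.
    by congr Config; rewrite /p; lia.
  - exact: agree_upd1.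
Qed.

End Compile.

(** Under an invariant [P], a body whose effect on the table depends only on the table and the
    counter turns the loop into a fold over counter values. This is how programs become functions on
    tables. *)
Lemma eval_for (inp : seq nat) (P : store -> Prop) i n c f h :
  i \notin wr c ->
  (forall h v, P h -> P (setr h i v)) -> (forall h, P h -> P (eval inp c h)) ->
  (forall h', P h' -> tb (eval inp c h') = f (tb h') (sc h' i)) ->
  P h -> tb (eval inp (CFor i n c) h) = foldl f (tb h) (iota 0 (sc h n)).
Proof.
move=> ic Pi Pc Hf Ph /=; set F := fun _ => _.
suff /(_ (sc h n) (leqnn _))[] : forall k, k <= sc h n ->
    tb (iter k F (setr h i 0)) = foldl f (tb h) (iota 0 k) /\
    P (iter k F (setr h i 0)) by [].
elim=> [_|k IHk lk]; first by split=> //; exact: Pi.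
have [IH1 IH2] := IHk (ltnW lk).
rewrite -addn1 iotaD foldl_cat add0n /= addn1 /=; split; last exact/Pi/Pc.
by rewrite Hf ?IH1 // eval_for_sc.
Qed.

(** * The decision program *)

(* Registers 20 to 34 hold constants of the run: 20 the number n of states,
   21 the number m of transitions, 22 n + m, 23 and 24 the sizes of the initial
   and specification sets, 25 k1 + 1, 26 k1 + k2 + 2, 27 k1 + k2 + 1, 28 n ^ 2,
   29 to 32 the offsets of the four lists in the input, 33 one, 34 zero. *)
Definition read_header : cmd :=
  CConst 33 1 ;; CConst 34 0 ;; CConst 17 0 ;; CRead 20 17 ;;
  CConst 17 3 ;; CRead 23 17 ;; CConst 17 4 ;; CRead 21 17 ;;
  CConst 17 5 ;; CRead 24 17 ;;
  CConst 17 6 ;; CRead 25 17 ;; CAdd 25 25 33 ;;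
  CConst 17 7 ;; CRead 27 17 ;; CAdd 27 25 27 ;; CAdd 26 27 33 ;;
  CConst 29 8 ;; CAdd 30 29 23 ;; CConst 17 1 ;; CRead 31 17 ;; CAdd 31 30 31 ;;
  CAdd 32 31 21 ;; CAdd 32 32 21 ;; CAdd 32 32 21 ;; CAdd 22 21 20 ;;
  CConst 28 0.

Definition square_states : cmd := CFor 6 20 (CAdd 28 28 20).

(** Multiplication by the number of states is repeated addition, the machine having no product. *)
Definition pair_index q x y : cmd :=
  CConst q 0 ;; CFor 6 20 (CAdd q q x) ;; CAdd q q y.

(** With truncated subtraction, a + (v - a) is the maximum of a and v. *)
Definition raise_cell : cmd :=
  CLoad 17 14 ;; CSub 18 16 17 ;; CAdd 17 17 18 ;; CStore 14 17.

(** Numbers below m are the listed transitions, and m + x is the idle unobservable move at state x.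
    The guard 1 - (m - e) vanishes exactly when e < m. The label takes two reads: the rank of the
    event, then the label code of that event. *)
Definition load_edge e x l y : cmd :=
  CSub 18 21 e ;; CSub 19 33 18 ;; CSub x e 21 ;; CAdd y x 34 ;; CConst l 0 ;;
  CUnless 19 (CAdd 17 e e ;; CAdd 17 17 e ;; CAdd 17 17 31 ;; CRead x 17 ;;
    CAdd 17 17 33 ;; CRead l 17 ;; CAdd l l 30 ;; CRead l l ;;
    CAdd 17 17 33 ;; CRead y 17).

(** In truncated arithmetic, c - (c - a) is the minimum of c and a; here c is the cap of the current
    phase. *)
Definition incr_value : cmd :=
  CAdd 16 15 34 ;; CSub 19 33 15 ;;
  CUnless 19 (CAdd 17 25 34 ;; CSub 18 15 25 ;; CSub 18 33 18 ;;
    CUnless 18 (CAdd 17 26 34) ;;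
    CAdd 16 15 33 ;; CSub 18 17 16 ;; CSub 16 17 18).

(** The two truncated differences of the labels add up to zero exactly when the labels agree. Only
    observable moves advance the stage. *)
Definition trans_body : cmd :=
  load_edge 2 7 8 9 ;; load_edge 3 10 11 12 ;;
  pair_index 13 7 10 ;; pair_index 14 9 12 ;;
  CLoad 15 13 ;; CSub 18 8 11 ;; CSub 19 11 8 ;; CAdd 18 18 19 ;;
  CUnless 18 (CAdd 16 15 34 ;; CSub 19 33 8 ;; CUnless 19 incr_value ;;
    raise_cell).

Definition init_body : cmd :=
  CAdd 17 29 2 ;; CRead 7 17 ;; CAdd 17 29 3 ;; CRead 10 17 ;;
  pair_index 14 7 10 ;; CConst 16 1 ;; raise_cell.

Definition spec_body : cmd :=
  CAdd 17 2 2 ;; CAdd 17 17 32 ;; CRead 7 17 ;; CAdd 17 17 33 ;; CRead 10 17 ;;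
  pair_index 14 7 10 ;; CLoad 16 14 ;;
  CSub 18 25 16 ;; CSub 19 16 25 ;; CAdd 18 18 19 ;;
  CUnless 18 (CAdd 16 16 33) ;; raise_cell.

Definition one_round : cmd :=
  CFor 2 23 (CFor 3 23 init_body) ;; CFor 2 22 (CFor 3 22 trans_body) ;;
  CFor 2 24 spec_body.

(** Nesting two loops gives n ^ 2 * (k1 + k2 + 2) rounds with no product to compute. The excess over
    k1 + k2 + 1, summed over the table, is zero exactly when no cell records a violation, and then
    the answer register gets one. *)
Definition main_loops : cmd :=
  CFor 4 28 (CFor 5 26 one_round) ;;
  CConst 15 0 ;; CFor 2 28 (CLoad 17 2 ;; CSub 17 17 27 ;; CAdd 15 15 17) ;;
  CSub 0 33 15.

(** The case [q == 20] is there because clearing the target would then clear the loop bound too. *)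
Lemma eval_pair_index inp q x y h :
  q != x -> q != y -> q != 6 -> x != 6 -> y != 6 ->
  sc (eval inp (pair_index q x y) h) q =
  sc h x * (if q == 20 then 0 else sc h 20) + sc h y.
Proof.
move=> /negbTE qx /negbTE qy /negbTE q6 /negbTE x6 /negbTE y6 /=.
set F := fun _ => _; set h0 := setr _ 6 0.
have E k : sc (iter k F h0) q = k * sc h x /\ forall r, r != q -> r != 6 ->
    sc (iter k F h0) r = sc h r.
  elim: k => [|k [IH1 IH2]] /=.
    rewrite /upd eqxx q6 mul0n; split=> // r /negbTE -> /negbTE ->; done.
  rewrite /= /upd /= q6 eqxx IH1 IH2 ?x6 1?eq_sym ?qx // mulSn addnC; split=> //.
  by move=> r rq r6; rewrite (negbTE r6) (negbTE rq) IH2.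
rewrite [in LHS]/upd eqxx.
have [-> _] := E (upd (sc h) q 0 20); have [_ ->] := E (upd (sc h) q 0 20).
- by rewrite /upd [20 == q]eq_sym mulnC.
- by rewrite eq_sym qy.
- by rewrite y6.
Qed.

(* Sealed so that unification never executes a command to compare two stores. *)
Fact den_key : unit. Proof. exact: tt. Qed.
Definition den := locked_with den_key eval.
Definition put := locked_with den_key setr.
Lemma putE : put = setr. Proof. exact: locked_withE. Qed.
Lemma denE : den = eval. Proof. exact: locked_withE. Qed.

Lemma den_sc inp c h r : r \notin wr c -> sc (den inp c h) r = sc h r.
Proof. by rewrite denE; exact: eval_sc. Qed.

Lemma den_tb inp c h : nost c -> tb (den inp c h) = tb h.
Proof. by rewrite denE; exact: eval_tb. Qed.


Lemma sc_put h i v j : sc (put h i v) j = if j == i then v else sc h j.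
Proof. by rewrite putE. Qed.

Lemma tb_put h i v : tb (put h i v) = tb h.
Proof. by rewrite putE. Qed.

Lemma den_seq inp c d h : den inp (c ;; d) h = den inp d (den inp c h).
Proof. by rewrite denE ?putE. Qed.

Lemma den_const inp i v h : den inp (CConst i v) h = put h i v.
Proof. by rewrite denE ?putE. Qed.

Lemma den_add inp i j k h : den inp (CAdd i j k) h = put h i (sc h j + sc h k).
Proof. by rewrite denE ?putE. Qed.

Lemma den_sub inp i j k h : den inp (CSub i j k) h = put h i (sc h j - sc h k).
Proof. by rewrite denE ?putE. Qed.

Lemma den_read inp i j h : den inp (CRead i j) h = put h i (nth 0 inp (sc h j)).
Proof. by rewrite denE ?putE. Qed.

Lemma den_load inp i j h : den inp (CLoad i j) h = put h i (tb h (sc h j)).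
Proof. by rewrite denE ?putE. Qed.

Lemma den_store inp i j h : den inp (CStore i j) h = sett h (sc h i) (sc h j).
Proof. by rewrite denE ?putE. Qed.

Lemma den_unless inp r c h :
  den inp (CUnless r c) h = if 0 < sc h r then h else den inp c h.
Proof. by rewrite denE ?putE. Qed.

Lemma den_iter inp i j c h : den inp (CFor i j c) h =
  iter (sc h j) (fun h' => put (den inp c h') i (sc (den inp c h') i).+1)
       (put h i 0).
Proof. by rewrite denE putE. Qed.

Ltac read_regs := rewrite /= ?tb_put; repeat (rewrite sc_put /=).
Ltac exec1 := first
  [ rewrite den_const | rewrite den_add; read_regs | rewrite den_sub; read_regs
  | rewrite den_read; read_regs | rewrite den_load; read_regs
  | rewrite den_store; read_regs | rewrite den_seq ].
Ltac exec := rewrite /=; repeat exec1; read_regs.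

(** * The program as a sequence of operations on the table *)

Section Semantics.
Variable inp : seq nat.
Variables n m ni ns k1 k2 oL oT oS : nat.

Definition consts (h : store) :=
  [/\ sc h 20 = n, sc h 21 = m, sc h 22 = m + n, sc h 23 = ni & sc h 24 = ns]
  /\ [/\ sc h 25 = k1.+1, sc h 26 = (k1 + k2).+2, sc h 27 = (k1 + k2).+1,
         sc h 28 = n * n & sc h 29 = 8]
  /\ [/\ sc h 30 = oL, sc h 31 = oT, sc h 32 = oS, sc h 33 = 1 & sc h 34 = 0].

(** Constants of the run live in registers 20 and above, so commands of this kind preserve them. *)
Definition low (c : cmd) := all (fun i => i < 20) (wr c).

Lemma consts_eq h h' : (forall r, 20 <= r -> sc h' r = sc h r) ->
  consts h -> consts h'.
Proof. by move=> E; rewrite /consts !E. Qed.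

Lemma consts_den c h : low c -> consts h -> consts (den inp c h).
Proof.
move=> lc; apply: consts_eq => r lr; apply: den_sc.
by apply/negP => /(allP lc); rewrite ltnNge lr.
Qed.

Lemma consts_put h i v : i < 20 -> consts h -> consts (put h i v).
Proof.
move=> li; apply: consts_eq => r lr; rewrite sc_put; case: (r =P i) => // ri.
by move: lr; rewrite ri leqNgt li.
Qed.

Definition idx x y := x * n + y.

Definition esrc e := if e < m then nth 0 inp (3 * e + oT) else e - m.
Definition elab e :=
  if e < m then nth 0 inp (nth 0 inp (3 * e + oT).+1 + oL) else 0.
Definition edst e := if e < m then nth 0 inp (3 * e + oT).+2 else e - m.

(** Only meeting a specified pair may start the second phase. Counting therefore saturates at the
    last stage of the current phase, and an unreached pair stays unreached. *)
Definition incv v :=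
  if v == 0 then 0 else minn (if v <= k1.+1 then k1.+1 else (k1 + k2).+2) v.+1.
(** Stage k1 + 1 certifies k1 observations; k1 + 2 opens the second phase with none counted yet. *)
Definition bumpv v := if v == k1.+1 then v.+1 else v.

Definition raise (A : nat -> nat) q v := upd A q (maxn (A q) v).

Definition init_step A i j :=
  raise A (idx (nth 0 inp (8 + i)) (nth 0 inp (8 + j))) 1.

Definition trans_step A e1 e2 :=
  if elab e1 == elab e2 then
    let v := A (idx (esrc e1) (esrc e2)) in
    raise A (idx (edst e1) (edst e2)) (if elab e1 == 0 then v else incv v)
  else A.

Definition spec_step A i :=
  let q := idx (nth 0 inp (2 * i + oS)) (nth 0 inp (2 * i + oS).+1) in
  raise A q (bumpv (A q)).

Definition round A :=
  let A1 := foldl (fun A i => foldl (init_step^~ i) A (iota 0 ni)) A (iota 0 ni) in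
  let A2 := foldl (fun A e => foldl (trans_step^~ e) A (iota 0 (m + n))) A1
                  (iota 0 (m + n)) in
  foldl spec_step A2 (iota 0 ns).

Lemma den_for (P : store -> Prop) i n' c f h :
  i \notin wr c ->
  (forall h v, P h -> P (put h i v)) -> (forall h, P h -> P (den inp c h)) ->
  (forall h', P h' -> tb (den inp c h') = f (tb h') (sc h' i)) ->
  P h -> tb (den inp (CFor i n' c) h) = foldl f (tb h) (iota 0 (sc h n')).
Proof. by rewrite denE putE; exact: eval_for. Qed.

Lemma den_load_edge1 h (h' := den inp (load_edge 2 7 8 9) h) : consts h ->
  [/\ sc h' 7 = esrc (sc h 2), sc h' 8 = elab (sc h 2) & sc h' 9 = edst (sc h 2)].
Proof.
rewrite {}/h' /consts /esrc /elab /edst.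
move=> [[_ E21 _ _ _] [_ [E30 E31 _ E33 E34]]].
rewrite /load_edge; exec; rewrite den_unless; read_regs; rewrite E21 E33.
have -> : 3 * sc h 2 = sc h 2 + sc h 2 + sc h 2 by lia.
case: (ltnP (sc h 2) m) => em.
  have -> : (0 < 1 - (m - sc h 2)) = false by lia.
  by exec; rewrite E31 E30 E33 !addn1.
have -> : 0 < 1 - (m - sc h 2) by lia.
by exec; rewrite E34 addn0.
Qed.

Lemma den_load_edge2 h (h' := den inp (load_edge 3 10 11 12) h) : consts h ->
  [/\ sc h' 10 = esrc (sc h 3), sc h' 11 = elab (sc h 3)
    & sc h' 12 = edst (sc h 3)].
Proof.
rewrite {}/h' /consts /esrc /elab /edst.
move=> [[_ E21 _ _ _] [_ [E30 E31 _ E33 E34]]].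
rewrite /load_edge; exec; rewrite den_unless; read_regs; rewrite E21 E33.
have -> : 3 * sc h 3 = sc h 3 + sc h 3 + sc h 3 by lia.
case: (ltnP (sc h 3) m) => em.
  have -> : (0 < 1 - (m - sc h 3)) = false by lia.
  by exec; rewrite E31 E30 E33 !addn1.
have -> : 0 < 1 - (m - sc h 3) by lia.
by exec; rewrite E34 addn0.
Qed.

Lemma tb_raise_cell h :
  tb (den inp raise_cell h) = raise (tb h) (sc h 14) (sc h 16).
Proof. by rewrite /raise_cell; exec; rewrite /raise maxnE. Qed.

Lemma den_incr_value h : consts h ->
  sc (den inp incr_value h) 16 = incv (sc h 15).
Proof.
rewrite /consts => -[_ [[E25 E26 _ _ _] [_ _ _ E33 E34]]].
rewrite /incr_value; exec; rewrite den_unless; read_regs; rewrite E33 E34 addn0 /incv.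
case: (posnP (sc h 15)) => [v0|v0]; first by rewrite v0; read_regs.
have -> : (0 < 1 - sc h 15) = false by lia.
exec; rewrite den_unless; read_regs; rewrite E25 E33 E34 addn0.
case: (leqP (sc h 15) k1.+1) => lv.
  have -> : 0 < 1 - (sc h 15 - k1.+1) by lia.
  by exec; rewrite E33; lia.
have -> : (0 < 1 - (sc h 15 - k1.+1)) = false by lia.
by exec; rewrite E33 E34 E26; lia.
Qed.

Lemma den_pair_index q x y h :
  q != x -> q != y -> q != 6 -> x != 6 -> y != 6 ->
  sc (den inp (pair_index q x y) h) q =
  sc h x * (if q == 20 then 0 else sc h 20) + sc h y.
Proof. by rewrite denE; exact: eval_pair_index. Qed.

Lemma tb_trans_body h : consts h ->
  tb (den inp trans_body h) = trans_step (tb h) (sc h 2) (sc h 3).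
Proof.
move=> ch; rewrite /trans_body; do 4!rewrite den_seq.
have [E7 E8 E9] := den_load_edge1 ch.
set h1 := den inp _ h in E7 E8 E9 *.
have c1 : consts h1 by exact: consts_den.
have h13 : sc h1 3 = sc h 3 by exact: den_sc.
have t1 : tb h1 = tb h by exact: den_tb.
have := den_load_edge2 c1; rewrite h13.
set h2 := den inp _ h1 => -[E10 E11 E12].
have c2 : consts h2 by exact: consts_den.
have t2 : tb h2 = tb h by rewrite -t1; exact: den_tb.
have {}E7 : sc h2 7 = esrc (sc h 2) by rewrite -E7; exact: den_sc.
have {}E8 : sc h2 8 = elab (sc h 2) by rewrite -E8; exact: den_sc.
have {}E9 : sc h2 9 = edst (sc h 2) by rewrite -E9; exact: den_sc.
have E20 : sc h2 20 = n by case: c2 => -[].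
have := den_pair_index h2 (isT : 13 != 7) (isT : 13 != 10) isT isT isT.
rewrite [_ == 20]/= E20 E7 E10; set h3 := den inp _ h2 => E13.
have c3 : consts h3 by exact: consts_den.
have t3 : tb h3 = tb h by rewrite -t2; exact: den_tb.
have E20' : sc h3 20 = n by case: c3 => -[].
have := den_pair_index h3 (isT : 14 != 9) (isT : 14 != 12) isT isT isT.
rewrite [_ == 20]/= E20' !(den_sc _ (c := pair_index 13 7 10)) // E9 E12.
set h4 := den inp _ h3 => E14.
have c4 : consts h4 by exact: consts_den.
have t4 : tb h4 = tb h by rewrite -t3; exact: den_tb.
have {}E13 : sc h4 13 = idx (esrc (sc h 2)) (esrc (sc h 3)).
  by rewrite /idx -E13; exact: den_sc.
have {}E8 : sc h4 8 = elab (sc h 2).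
  by rewrite !(den_sc, E8).
have {}E11 : sc h4 11 = elab (sc h 3).
  by rewrite !(den_sc, E11).
clearbody h4; move: h4 c4 t4 E13 E14 E8 E11 => g cg tg E13 E14 E8 E11.
have E33 : sc g 33 = 1 by case: cg => _ [_ []].
have E34 : sc g 34 = 0 by case: cg => _ [_ []].
exec; rewrite den_unless; read_regs; rewrite E8 E11 E13 tg /trans_step.
case: (elab (sc h 2) =P elab (sc h 3)) => el; last first.
  by case: ltnP => [|ll]; [rewrite ?tb_put | lia].
rewrite el subnn /=; do 5 exec1; rewrite den_unless; read_regs.
rewrite E8 E33 E34 addn0 el.
case: (posnP (elab (sc h 3))) => l0.
  by rewrite tb_raise_cell l0 /=; read_regs; rewrite tg E14 addn0.
have -> : (0 < 1 - elab (sc h 3)) = false by lia.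
rewrite tb_raise_cell den_incr_value; last by do ![apply: consts_put => //].
by rewrite den_tb // den_sc //; read_regs; rewrite tg E14.
Qed.

Lemma tb_init_body h : consts h ->
  tb (den inp init_body h) = init_step (tb h) (sc h 2) (sc h 3).
Proof.
move=> ch; have E29 : sc h 29 = 8 by case: ch => _ [[]].
have E20 : sc h 20 = n by case: ch => -[].
rewrite /init_body; do 5!rewrite den_seq.
rewrite den_seq den_const tb_raise_cell.
set h1 := den inp (CRead 10 17) _.
have E : [/\ sc h1 7 = nth 0 inp (8 + sc h 2), sc h1 10 = nth 0 inp (8 + sc h 3),
    sc h1 20 = n & tb h1 = tb h].
  by rewrite /h1; exec; rewrite E29 E20.
case: E => E7 E10 {}E20 E1.
have := den_pair_index h1 (isT : 14 != 7) (isT : 14 != 10) isT isT isT.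
rewrite [_ == 20]/= E20 E7 E10 => E14.
by read_regs; rewrite E14 den_tb // E1.
Qed.

Lemma tb_spec_body h : consts h ->
  tb (den inp spec_body h) = spec_step (tb h) (sc h 2).
Proof.
move=> ch; have E32 : sc h 32 = oS by case: ch => _ [_ []].
have E33 : sc h 33 = 1 by case: ch => _ [_ []].
have E25 : sc h 25 = k1.+1 by case: ch => _ [[]].
have E20 : sc h 20 = n by case: ch => -[].
rewrite /spec_body; do 6!rewrite den_seq.
set h1 := den inp (CRead 10 17) _.
have E : [/\ sc h1 7 = nth 0 inp (2 * sc h 2 + oS),
    sc h1 10 = nth 0 inp (2 * sc h 2 + oS).+1, sc h1 20 = n & tb h1 = tb h] /\
    sc h1 25 = k1.+1 /\ sc h1 33 = 1.
  rewrite /h1; exec; rewrite E32 E20 E33 addn1.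
  by have -> : 2 * sc h 2 = sc h 2 + sc h 2 by lia.
clearbody h1; case: E => -[E7 E10 {}E20 E1] [{}E25 {}E33].
have := den_pair_index h1 (isT : 14 != 7) (isT : 14 != 10) isT isT isT.
rewrite [_ == 20]/= E20 E7 E10; set g := den inp _ h1 => E14.
have tg : tb g = tb h by rewrite -E1; exact: den_tb.
have {}E25 : sc g 25 = k1.+1 by rewrite -E25; exact: den_sc.
have {}E33 : sc g 33 = 1 by rewrite /g den_sc.
clearbody g; do 9 exec1; rewrite tb_raise_cell den_unless; read_regs.
rewrite E14 E25 tg /spec_step /bumpv -/(idx _ _).
set v := tb h _; case: (v =P k1.+1) => [->|vk].
  by rewrite subnn /=; exec; rewrite E33 E14 tg addn1.
by case: ltnP => [_|?]; [read_regs; rewrite E14 tg | lia].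
Qed.

Lemma tb_one_round h : consts h ->
  tb (den inp one_round h) = round (tb h).
Proof.
have cd c g : low c -> consts g -> consts (den inp c g) by exact: consts_den.
move=> ch; rewrite /one_round !den_seq /round.
have E23 g : consts g -> sc g 23 = ni by case=> -[].
have E22 g : consts g -> sc g 22 = m + n by case=> -[].
have E24 g : consts g -> sc g 24 = ns by case=> -[].
(* The body of an inner loop also uses the outer counter, register 2, so its value joins the
   invariant. *)
have P3 a : forall g i, (consts g /\ sc g 2 = a) ->
    consts (put g 3 i) /\ sc (put g 3 i) 2 = a.
  by move=> g i [cg <-]; rewrite sc_put /=; split=> //; exact: consts_put.
have P2 : forall g i, consts g -> consts (put g 2 i) by move=> *; exact: consts_put.
have Pc a c : low c -> 2 \notin wr c -> forall g, (consts g /\ sc g 2 = a) ->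
    consts (den inp c g) /\ sc (den inp c g) 2 = a.
  by move=> lc nc g [cg <-]; rewrite den_sc //; split=> //; exact: cd.
rewrite (@den_for consts _ _ _ spec_step) //; last first.
- by do 2 apply: (cd) => //.
- by move=> g cg; exact: tb_spec_body.
- by move=> g; exact: cd.
rewrite E24; last by do 2 apply: (cd) => //.
congr (foldl _ _ _).
rewrite (@den_for consts _ _ _
  (fun A e => foldl (trans_step^~ e) A (iota 0 (m + n)))) //; last first.
- exact: cd.
- move=> g cg; rewrite (@den_for (fun h' => consts h' /\ sc h' 2 = sc g 2) _ _ _
    (trans_step^~ (sc g 2))) ?E22 //; [exact: P3 | exact: Pc | ].
  by move=> h' [ch' <-]; exact: tb_trans_body.
- by move=> g; exact: cd.
rewrite E22; last exact: cd.
congr (foldl _ _ _).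
rewrite (@den_for consts _ _ _
  (fun A i => foldl (init_step^~ i) A (iota 0 ni))) ?E23 //; last first.
- move=> g cg; rewrite (@den_for (fun h' => consts h' /\ sc h' 2 = sc g 2) _ _ _
    (init_step^~ (sc g 2))) ?E23 //; [exact: P3 | exact: Pc | ].
  by move=> h' [ch' <-]; exact: tb_init_body.
- by move=> g; exact: cd.
Qed.

Lemma foldl_const (T I : Type) (f : T -> T) (s : seq I) x :
  foldl (fun y _ => f y) x s = iter (size s) f x.
Proof. by elim: s x => //= i s IH x; rewrite IH -iterSr. Qed.

Lemma den_main_loops h : consts h ->
  (0 < sc (den inp main_loops h) 0) =
  ~~ has (fun a => (k1 + k2).+1 < iter (n * n * (k1 + k2).+2) round (tb h) a)
         (iota 0 (n * n)).
Proof.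
move=> ch; rewrite /main_loops !den_seq den_sub; read_regs.
have cd c g : low c -> consts g -> consts (den inp c g) by exact: consts_den.
set h1 := den inp (CFor 4 28 _) h; have c1 : consts h1 by exact: cd.
have -> : iter (n * n * (k1 + k2).+2) round (tb h) = tb h1.
  have E28 g : consts g -> sc g 28 = n * n by case=> _ [[]].
  have E26 g : consts g -> sc g 26 = (k1 + k2).+2 by case=> _ [[]].
  rewrite /h1 (@den_for consts _ _ _ (fun A _ => iter (k1 + k2).+2 round A)) //.
  - by rewrite foldl_const size_iota E28 // iterM.
  - by move=> *; exact: consts_put.
  - by move=> g; exact: cd.
  - move=> g cg; rewrite (@den_for consts _ _ _ (fun A _ => round A)) //.
    + by rewrite foldl_const size_iota E26.
    + by move=> *; exact: consts_put.
    + by move=> h'; exact: cd.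
    + by move=> h' ch'; exact: tb_one_round.
have E27 : sc h1 27 = (k1 + k2).+1 by case: c1 => _ [[]].
have E28 : sc h1 28 = n * n by case: c1 => _ [[]].
have E33 : sc h1 33 = 1 by case: c1 => _ [_ []].
rewrite den_sc // den_const sc_put /= E33.
clearbody h1; move: h1 E27 E28 {c1 E33} => g E27 E28.
rewrite den_iter sc_put /= E28.
set F := fun _ => _; set g0 := put _ _ _.
have E k : [/\ sc (iter k F g0) 2 = k, sc (iter k F g0) 27 = (k1 + k2).+1,
    tb (iter k F g0) = tb g &
    (0 < sc (iter k F g0) 15) = has (fun a => (k1 + k2).+1 < tb g a) (iota 0 k)].
  elim: k => [|k [IH1 IH2 IH3 IH4]]; first by rewrite /g0 /=; read_regs.
  rewrite -[in iota _ _]addn1 iotaD has_cat /= orbF add0n -IH4.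
  move: IH1 IH2 IH3; set u := iter k F g0 => IH1 IH2 IH3.
  rewrite /= /F; exec.
  rewrite IH1 IH2 IH3; split=> //.
  by rewrite addn_gt0 subn_gt0.
by have [_ _ _ <-] := E (n * n); lia.
Qed.

End Semantics.

(** * Initialisation of the registers *)

Lemma consts_setup S (Xspec : {set state S * state S}) k1 k2
    (inp := instance_code Xspec k1 k2) (h0 := Store (fun=> 0) (fun=> 0)) :
  consts #|state S| #|trans S| #|init S| #|Xspec| k1 k2
    (8 + #|init S|) (8 + #|init S| + #|event S|)
    (8 + #|init S| + #|event S| + 3 * #|trans S|)
    (den inp square_states (den inp read_header h0)) /\
  tb (den inp square_states (den inp read_header h0)) = fun=> 0.
Proof.
rewrite !den_tb //; split=> //.
set h := den inp read_header h0.
(* The header sets every constant but n ^ 2, whose register is patched here and accounted for by the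
   squaring loop below. *)
have E : consts #|state S| #|trans S| #|init S| #|Xspec| k1 k2
    (8 + #|init S|) (8 + #|init S| + #|event S|)
    (8 + #|init S| + #|event S| + 3 * #|trans S|) (put h 28 (#|state S| * #|state S|))
    /\ sc h 28 = 0.
  have : h = h by [].
  rewrite {1}/h /read_header; exec => <-.
  rewrite /consts; read_regs; split=> //; split; [|split]; split=> //; lia.
clearbody h; case: E => ch E28.
rewrite /square_states den_iter.
have E20 : sc h 20 = #|state S| by case: ch => -[]; rewrite sc_put.
rewrite E20; set F := fun _ => _.
suff E k r : sc (iter k F (put h 6 0)) r =
    sc (put (put h 28 (k * #|state S|)) 6 k) r.
  apply: consts_eq ch => r lr; rewrite E !sc_put.
  by case: (r =P 6) => // r6; move: lr; rewrite r6.
elim: k r => [|k IHk] r.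
  by rewrite /= !sc_put mul0n; case: (r =P 28) => [->|//]; rewrite E28.
rewrite iterS /F den_add !sc_put !IHk !sc_put /= E20 mulSn addnC.
by case: (r == 6); case: (r == 28).
Qed.

(** * Lookup in concatenated lists *)

Lemma nth_flatten_const (T : Type) (f : T -> seq nat) d x0 s i j :
  (forall x, size (f x) = d) -> i < size s -> j < d ->
  nth 0 (flatten [seq f x | x <- s]) (d * i + j) = nth 0 (f (nth x0 s i)) j.
Proof.
move=> Hf + lj; elim: s i => //= x s IH [_|i li]; rewrite nth_cat Hf.
  by rewrite muln0 add0n lj.
rewrite mulnS -addnA ltnNge leq_addr /= addKn; exact: IH.
Qed.

Lemma size_flatten_const (T : Type) (f : T -> seq nat) d s :
  (forall x, size (f x) = d) -> size (flatten [seq f x | x <- s]) = d * size s.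
Proof.
move=> Hf; elim: s => /= [|x s IH]; first by rewrite muln0.
by rewrite size_cat Hf IH mulnS.
Qed.

Lemma nth_cat_add (T : Type) (x0 : T) s1 s2 i :
  nth x0 (s1 ++ s2) (size s1 + i) = nth x0 s2 i.
Proof. by rewrite nth_cat ltnNge leq_addr /= addKn. Qed.

Lemma foldl_inv (T : Type) (I : eqType) (f : T -> I -> T) (P : T -> Prop) s x :
  (forall y i, i \in s -> P y -> P (f y i)) -> P x -> P (foldl f x s).
Proof.
elim: s x => //= i s IH x Hf Px; apply: IH => [y j js|].
  by apply: Hf; rewrite inE js orbT.
by apply: Hf; rewrite ?inE ?eqxx.
Qed.

(** * Updates that only increase a table *)

Definition below (A B : nat -> nat) := forall a, A a <= B a.

Lemma below_foldl (I : Type) (f : (nat -> nat) -> I -> nat -> nat) s A :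
  (forall B i, below B (f B i)) -> below A (foldl f A s).
Proof.
move=> Hf; elim: s A => [|i s IH] A a //=.
exact: leq_trans (Hf A i a) (IH _ a).
Qed.

(** No step can decrease the table, so a fold that ends where it began cannot have moved at any
    step. *)
Lemma foldl_fixed (I : eqType) (f : (nat -> nat) -> I -> nat -> nat) s A :
  (forall B i, below B (f B i)) -> foldl f A s = A ->
  forall i, i \in s -> f A i = A.
Proof.
move=> Hf; elim: s => //= j s IH E.
have Ej : f A j = A.
  apply: funext => a; apply/eqP; rewrite eqn_leq Hf andbT.
  by rewrite -[X in _ <= X a]E; exact: below_foldl.
rewrite Ej in E; move=> i; rewrite inE => /orP[/eqP -> //|].
exact: IH.
Qed.

Lemma below_raise A q v : below A (raise A q v).
Proof.
by move=> a; rewrite /raise /upd; case: (a =P q) => [->|//]; exact: leq_maxl.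
Qed.

(** * Correctness of the final table *)

Section Correctness.
Variables (S : fsa) (Xspec : {set state S * state S}) (k1 k2 : nat).

Local Notation n := #|state S|.
Local Notation m := #|trans S|.
Local Notation inp := (instance_code Xspec k1 k2).
Local Notation oL := (8 + #|init S|).
Local Notation oT := (8 + #|init S| + #|event S|).
Local Notation oS := (8 + #|init S| + #|event S| + 3 * #|trans S|).
Local Notation src := (esrc inp m oT).
Local Notation dst := (edst inp m oT).
Local Notation lbl := (elab inp m oL oT).
Local Notation cell := (fun x y : state S => idx n (enum_rank x) (enum_rank y)).
Local Notation inc := (incv k1 k2).
Local Notation bump := (bumpv k1).

(** * Decoding the instance *)

Lemma nth_init i x0 : i < #|init S| ->
  nth 0 inp (8 + i) = enum_rank (nth x0 (enum (init S)) i).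
Proof.
move=> li; rewrite /instance_code /= nth_cat size_map -cardE li.
by rewrite (nth_map x0) // -cardE.
Qed.

Lemma nth_lab (t : event S) : nth 0 inp (enum_rank t + oL) = lab_code t.
Proof.
have le : enum_rank t < size (enum (event S)) by rewrite -cardE.
rewrite /instance_code addnC -addnA.
rewrite (nth_cat_add _ [:: _; _; _; _; _; _; _; _]).
have -> : #|init S| = size [seq enum_rank x : nat | x <- enum (init S)].
  by rewrite size_map -cardE.
rewrite nth_cat_add nth_cat size_map le.
by rewrite (nth_map t) // nth_enum_rank.
Qed.

Lemma nth_trans e j e0 : e < m -> j < 3 ->
  nth 0 inp (3 * e + oT + j) = nth 0 (trans_code (nth e0 (enum (trans S)) e)) j.
Proof.
move=> le lj; rewrite /instance_code.
have -> : 3 * e + oT + j = 8 + (#|init S| + (#|event S| + (3 * e + j))) by lia.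
rewrite (nth_cat_add _ [:: _; _; _; _; _; _; _; _]).
have -> : #|init S| = size [seq enum_rank x : nat | x <- enum (init S)].
  by rewrite size_map -cardE.
rewrite nth_cat_add.
have -> : #|event S| = size [seq lab_code t | t <- enum (event S)].
  by rewrite size_map -cardE.
have sz : size (flatten [seq trans_code e | e <- enum (trans S)]) = 3 * m.
  by rewrite (@size_flatten_const _ _ 3) // -cardE.
rewrite nth_cat_add nth_cat sz.
have -> : 3 * e + j < 3 * m by lia.
by rewrite (nth_flatten_const e0) // -cardE.
Qed.

Lemma nth_spec i j e0 : i < #|Xspec| -> j < 2 ->
  nth 0 inp (2 * i + oS + j) = nth 0 (spec_code (nth e0 (enum Xspec) i)) j.
Proof.
move=> li lj; rewrite /instance_code.
have -> : 2 * i + oS + j = 8 + (#|init S| + (#|event S| + (3 * m + (2 * i + j)))).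
  by lia.
rewrite (nth_cat_add _ [:: _; _; _; _; _; _; _; _]).
have -> : #|init S| = size [seq enum_rank x : nat | x <- enum (init S)].
  by rewrite size_map -cardE.
rewrite nth_cat_add.
have -> : #|event S| = size [seq lab_code t | t <- enum (event S)].
  by rewrite size_map -cardE.
have <- : size (flatten [seq trans_code e | e <- enum (trans S)]) = 3 * m.
  by rewrite (@size_flatten_const _ _ 3) // -cardE.
by rewrite !nth_cat_add (nth_flatten_const e0) // -cardE.
Qed.

Lemma init_at i : i < #|init S| ->
  exists2 x, x \in init S & nth 0 inp (8 + i) = enum_rank x.
Proof.
move=> li; have [x0 _] : exists x, x \in init S by apply/card_gt0P; lia.
exists (nth x0 (enum (init S)) i); last exact: nth_init.
by rewrite -mem_enum mem_nth // -cardE.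
Qed.

Lemma init_has x : x \in init S ->
  exists2 i, i < #|init S| & nth 0 inp (8 + i) = enum_rank x.
Proof.
move=> xi; have li : index x (enum (init S)) < #|init S|.
  by rewrite cardE index_mem mem_enum.
by exists (index x (enum (init S))); rewrite // (nth_init x) // nth_index ?mem_enum.
Qed.

Lemma spec_at i : i < #|Xspec| -> exists x y, [/\ (x, y) \in Xspec,
  nth 0 inp (2 * i + oS) = enum_rank x & nth 0 inp (2 * i + oS).+1 = enum_rank y].
Proof.
move=> li; have [e0 _] : exists e, e \in Xspec by apply/card_gt0P; lia.
have := @nth_spec i 0 e0 li isT; have := @nth_spec i 1 e0 li isT.
have : nth e0 (enum Xspec) i \in Xspec by rewrite -mem_enum mem_nth // -cardE.
case: (nth _ _ _) => x y xy; rewrite addn1 addn0 /= => E1 E0.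
by exists x, y.
Qed.

Lemma spec_has x y : (x, y) \in Xspec -> exists i, [/\ i < #|Xspec|,
  nth 0 inp (2 * i + oS) = enum_rank x & nth 0 inp (2 * i + oS).+1 = enum_rank y].
Proof.
move=> xy; have li : index (x, y) (enum Xspec) < #|Xspec|.
  by rewrite cardE index_mem mem_enum.
have := nth_spec (x, y) li (isT : 0 < 2).
have := nth_spec (x, y) li (isT : 1 < 2).
rewrite nth_index ?mem_enum // addn1 addn0 /= => E1 E0.
by exists (index (x, y) (enum Xspec)).
Qed.

(* Transitions together with an idle unobservable move at every state, so that
   one component of a pair can move alone. *)
Definition ext (x : state S) l (y : state S) :=
  (exists2 t, (x, t, y) \in trans S & lab_code t = l) \/ (l = 0 /\ x = y).

Lemma ext_at e : e < m + n -> exists x l y, ext x l y /\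
  [/\ src e = enum_rank x, lbl e = l & dst e = enum_rank y].
Proof.
rewrite /esrc /elab /edst => le; case: ltnP => lem; last first.
  have lx : e - m < n by lia.
  exists (enum_val (Ordinal lx)), 0, (enum_val (Ordinal lx)).
  by rewrite enum_valK; split=> //; right.
have [e0 _] : exists e, e \in trans S by apply/card_gt0P; lia.
have := @nth_trans e 0 e0 lem isT; have := @nth_trans e 1 e0 lem isT.
have := @nth_trans e 2 e0 lem isT.
have : nth e0 (enum (trans S)) e \in trans S.
  by rewrite -mem_enum mem_nth // -cardE.
case: (nth _ _ _) => [[x t] y] xty; rewrite addn2 addn1 addn0 /= => -> -> ->.
exists x, (lab_code t), y; split; last by rewrite nth_lab.
by left; exists t.
Qed.

Lemma ext_has x l y : ext x l y -> exists e, e < m + n /\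
  [/\ src e = enum_rank x, lbl e = l & dst e = enum_rank y].
Proof.
rewrite /esrc /elab /edst => -[[t xty <-]|[-> ->]]; last first.
  exists (m + enum_rank y); rewrite ltn_add2l ltn_ord; split=> //.
  by rewrite ltnNge leq_addr addKn.
have li : index (x, t, y) (enum (trans S)) < m.
  by rewrite cardE index_mem mem_enum.
exists (index (x, t, y) (enum (trans S))); rewrite li; split; first by lia.
have := nth_trans (x, t, y) li (isT : 0 < 3).
have := nth_trans (x, t, y) li (isT : 1 < 3).
have := nth_trans (x, t, y) li (isT : 2 < 3).
by rewrite nth_index ?mem_enum // addn2 addn1 addn0 /= => -> -> ->; rewrite nth_lab.
Qed.

(** * Observed runs and the meaning of stages *)

Definition wrun (x : state S) w x' := exists2 s, labs s = w & fsa_run x s x'.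

Lemma fsa_run_cat (x y z : state S) s s' :
  fsa_run x s y -> fsa_run y s' z -> fsa_run x (s ++ s') z.
Proof.
elim: s x => /= [x -> //|t s IH x [u xtu ru] rs].
by exists u => //; exact: IH.
Qed.

Lemma wrun0 x : wrun x [::] x. Proof. by exists [::]. Qed.

Lemma wrun_eps x w y z : wrun x w y -> ext y 0 z -> wrun x w z.
Proof.
move=> [s ls rs] [[t yt lt]|[_ <-]]; last by exists s.
exists (s ++ [:: t]); last by apply: fsa_run_cat rs _; exists z.
rewrite /labs pmap_cat -[pmap _ s]/(labs s) ls /=.
by move: lt; rewrite /lab_code; case: (lab t) => //= _; rewrite cats0.
Qed.

Lemma wrun_obs x w y l z : wrun x w y -> ext y l.+1 z ->
  exists a, l = enum_rank a /\ wrun x (rcons w a) z.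
Proof.
move=> [s ls rs] [[t yt lt]|[]//].
move: lt; rewrite /lab_code; case E: (lab t) => [a|//] [<-].
exists a; split=> //; exists (s ++ [:: t]).
  by rewrite /labs pmap_cat -[pmap _ s]/(labs s) ls /= E /= cats1.
by apply: fsa_run_cat rs _; exists z.
Qed.

(* The meaning of a table value: 0 says nothing, c + 1 <= k1 + 1 says that the
   pair is reached after at least c observations, and k1 + 2 + c that moreover a
   specified pair was met after at least k1 observations and at least c
   observations ago. *)
Definition good x y v :=
  [\/ v = 0,
      v <= k1.+1 /\ exists w x0 y0, [/\ x0 \in init S, y0 \in init S,
        wrun x0 w x, wrun y0 w y & v <= (size w).+1] |
      v <= (k1 + k2).+2 /\ exists w1 w2 p q, [/\ (p, q) \in Xspec,
        (exists x0 y0, [/\ x0 \in init S, y0 \in init S,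
           wrun x0 w1 p & wrun y0 w1 q]),
        wrun p w2 x, wrun q w2 y & k1 <= size w1 /\ v <= size w2 + k1.+2]].

Lemma good_le x y v : good x y v -> v <= (k1 + k2).+2.
Proof. by case=> [->|[? _]|[? _]] //; lia. Qed.

Lemma good1 x y : x \in init S -> y \in init S -> good x y 1.
Proof.
move=> xi yi; apply: Or32; split=> //; exists [::], x, y.
by split=> //; exact: wrun0.
Qed.

Lemma good_eps x y v x' y' :
  good x y v -> ext x 0 x' -> ext y 0 y' -> good x' y' v.
Proof.
move=> gv ex ey; case: gv => [v0|[lv [w [x0 [y0 [? ? rx ry ?]]]]]|].
- exact: Or31.
- apply: Or32; split=> //; exists w, x0, y0.
  by split=> //; [exact: wrun_eps rx ex | exact: wrun_eps ry ey].
move=> [lv [w1 [w2 [p [q [? ? rx ry ?]]]]]].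
apply: Or33; split=> //; exists w1, w2, p, q.
by split=> //; [exact: wrun_eps rx ex | exact: wrun_eps ry ey].
Qed.

(** Equal positive label codes come from the same label, so both runs append the same letter to
    their common word. *)
Lemma good_obs x y v l x' y' :
  good x y v -> ext x l.+1 x' -> ext y l.+1 y' -> good x' y' (inc v).
Proof.
have sync a b : l = enum_rank a -> l = enum_rank b -> a = b :> label S.
  by move=> -> /ord_inj/enum_rank_inj.
move=> gv ex ey; rewrite /incv; case: (posnP v) => [_|v0]; first exact: Or31.
case: gv => [?|[lv [w [x0 [y0 [? ? rx ry ?]]]]]|]; first lia.
- have [a [la ra]] := wrun_obs rx ex; have [b [lb rb]] := wrun_obs ry ey.
  rewrite -(sync _ _ la lb) in rb; rewrite lv.
  apply: Or32; split; first exact: geq_minl.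
  by exists (rcons w a), x0, y0; split=> //; rewrite size_rcons; lia.
move=> [lv [w1 [w2 [p [q [pq [x0 [y0 [xi yi rp rq]]] rx ry [sw1 sw2]]]]]]].
have [a [la ra]] := wrun_obs rx ex; have [b [lb rb]] := wrun_obs ry ey.
rewrite -(sync _ _ la lb) in rb.
apply: Or33; split; first by case: ifP; lia.
exists w1, (rcons w2 a), p, q; split=> //; first by exists x0, y0.
by rewrite size_rcons; split=> //; lia.
Qed.

(** At stage k1 + 1 the current pair itself serves as the specified pair, followed by the empty
    word. *)
Lemma good_bump x y v : good x y v -> (x, y) \in Xspec -> good x y (bump v).
Proof.
move=> gv xy; rewrite /bumpv; case: eqP => // vk; rewrite vk in gv *.
apply: Or33; split; first by lia.
have [w [x0 [y0 [xi yi rx ry sw]]]] : exists w x0 y0, [/\ x0 \in init S,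
    y0 \in init S, wrun x0 w x, wrun y0 w y & k1 <= size w].
  case: gv => [//|[_ [w [x0 [y0 [? ? rx ry ?]]]]]|]; first by exists w, x0, y0.
  (* The third clause of [good] also admits the value k1 + 1; concatenating its two words then gives
     a long enough word leading to the current pair. *)
  move=> [_ [w1 [w2 [p [q [_ [x0 [y0 [? ? [s1 <- r1] [s2 e2 r2]]]]]]]]]].
  move=> [s3 <- r3] [s4 e4 r4] [? _]; exists (labs s1 ++ labs s3), x0, y0.
  split=> //; last by rewrite size_cat; lia.
    by exists (s1 ++ s3); rewrite ?/labs ?pmap_cat //; exact: fsa_run_cat r3.
  exists (s2 ++ s4); last exact: fsa_run_cat r4.
  by rewrite -e4 -e2 /labs pmap_cat.
exists w, [::], x, y; split=> //; try exact: wrun0.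
by exists x0, y0.
Qed.

(** * Soundness of the table *)

Lemma cell_inj x y x' y' : cell x y = cell x' y' -> x = x' /\ y = y'.
Proof.
rewrite /idx => E; have n0 : 0 < n by exact: leq_ltn_trans (ltn_ord (enum_rank x)).
have Ex : enum_rank x = enum_rank x' :> nat.
  have := congr1 (divn^~ n) E.
  by rewrite !divnMDl // !divn_small ?ltn_ord // !addn0.
split; apply/enum_rank_inj/ord_inj => //.
by move: E; rewrite Ex => /addnI.
Qed.

Lemma cell_lt x y : cell x y < n * n.
Proof.
rewrite /idx; apply: (@leq_trans (enum_rank x * n + n)); first by rewrite ltn_add2l.
by rewrite -mulSnr leq_mul2r ltn_ord orbT.
Qed.

(** This also forces every entry past the n ^ 2 genuine cells to be zero, so a sound table is
    determined by finitely many entries. *)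
Definition sound (A : nat -> nat) :=
  forall a, A a = 0 \/ exists x y, a = cell x y /\ good x y (A a).

Lemma sound_at A x y : sound A -> good x y (A (cell x y)).
Proof.
move=> sA; case: (sA (cell x y)) => [->|[x' [y' [/cell_inj[<- <-]]]]] //.
exact: Or31.
Qed.

(** The maximum of two good values is one of the two. *)
Lemma sound_raise A x y v : sound A -> good x y v -> sound (raise A (cell x y) v).
Proof.
move=> sA gv a; rewrite /raise /upd; case: (a =P cell x y) => [->|_]; last exact: sA.
right; exists x, y; split=> //; rewrite /maxn; case: ltnP => // _; exact: sound_at.
Qed.

Local Notation istep := (init_step inp n).
Local Notation tstep := (trans_step inp n m k1 k2 oL oT).
Local Notation sstep := (spec_step inp n k1 oS).
Local Notation rnd := (round inp n m #|init S| #|Xspec| k1 k2 oL oT oS).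

Lemma sound_round A : sound A -> sound (rnd A).
Proof.
have mi i k : i \in iota 0 k -> i < k by rewrite mem_iota.
move=> sA; rewrite /round.
apply: (@foldl_inv _ _ _ sound) => [B i /mi /spec_at[x [y [xy Ex Ey]]] sB|].
  rewrite /spec_step Ex Ey; apply: sound_raise => //.
  by apply: good_bump xy; exact: sound_at.
apply: (@foldl_inv _ _ _ sound) => [B i /mi li sB|].
  apply: (@foldl_inv _ _ _ sound _ _ _ sB) => C j /mi lj sC.
  have [x [l [x' [ex [Ex El Ex']]]]] := ext_at li.
  have [y [l' [y' [ey [Ey El' Ey']]]]] := ext_at lj.
  rewrite /trans_step Ex El Ex' Ey El' Ey'; case: eqP => // ll.
  apply: sound_raise => //; rewrite -ll in ey.
  case: l ex ey {El ll} => [|l] ex ey /=; first exact: good_eps (sound_at _ _ sC) ex ey.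
  exact: good_obs (sound_at _ _ sC) ex ey.
apply: (@foldl_inv _ _ _ sound _ _ _ sA) => B i /mi /init_at[x xi Ex] sB.
apply: (@foldl_inv _ _ _ sound _ _ _ sB) => C j /mi /init_at[y yi Ey] sC.
by rewrite /init_step Ex Ey; apply: sound_raise => //; exact: good1.
Qed.

(** * Closure properties of a fixed table *)

Lemma below_init_step A i j : below A (istep A i j).
Proof. exact: below_raise. Qed.

Lemma below_trans_step A i j : below A (tstep A i j).
Proof.
by rewrite /trans_step; case: eqP => _ => [|a //]; exact: below_raise.
Qed.

Lemma below_spec_step A i : below A (sstep A i).
Proof. exact: below_raise. Qed.

Lemma below_init_loop A i : below A (foldl (istep^~ i) A (iota 0 #|init S|)).
Proof. by apply: below_foldl => B j; exact: below_init_step. Qed.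

Lemma below_trans_loop A i : below A (foldl (tstep^~ i) A (iota 0 (m + n))).
Proof. by apply: below_foldl => B j; exact: below_trans_step. Qed.

Lemma below_round A : below A (rnd A).
Proof.
move=> a; rewrite /round.
apply: leq_trans _ (below_foldl _ _ below_spec_step _).
apply: leq_trans _ (below_foldl _ _ below_trans_loop _).
exact: (below_foldl _ _ below_init_loop).
Qed.

(** The three passes only increase the table, so if their composite fixes it, each pass does, and by
    [foldl_fixed] each single update does. An idle update is an inequality. *)
Lemma round_fixed A : rnd A = A ->
  [/\ forall x y, x \in init S -> y \in init S -> 0 < A (cell x y),
      forall x l x' y y', ext x l x' -> ext y l y' ->
        (if l == 0 then A (cell x y) else inc (A (cell x y))) <= A (cell x' y') &
      forall x y, (x, y) \in Xspec -> bump (A (cell x y)) <= A (cell x y)].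
Proof.
have mi i k : i < k -> i \in iota 0 k by rewrite mem_iota.
have sq A' B C : below A' B -> below B C -> C = A' -> B = A' /\ C = B.
  move=> AB BC CA; have E : B = A'.
    by apply: funext => a; apply/eqP; rewrite eqn_leq AB -[X in _ <= X a]CA BC.
  by rewrite CA E.
have fix_raise q v : raise A q v = A -> v <= A q.
  by move/(congr1 (@^~ q)); rewrite /raise /upd eqxx => <-; exact: leq_maxr.
rewrite /round; set A1 := foldl _ A _; set A2 := foldl _ A1 _ => E3.
have b1 : below A A1 := below_foldl _ _ below_init_loop.
have b2 : below A1 A2 := below_foldl _ _ below_trans_loop.
have b3 := @below_foldl _ _ (iota 0 #|Xspec|) A2 below_spec_step.
have b12 : below A A2 by move=> a; exact: leq_trans (b1 a) (b2 a).
have [E2 _] := sq _ _ _ b12 b3 E3; have [E1 _] := sq _ _ _ b1 b2 E2.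
rewrite E2 in E3; rewrite /A2 E1 in E2; rewrite /A1 in E1.
split.
- move=> x y /init_has[i /mi li Ei] /init_has[j /mi lj Ej].
  have := foldl_fixed (fun B => below_init_step B i)
    (foldl_fixed below_init_loop E1 li) lj.
  by rewrite /init_step Ei Ej => /fix_raise.
- move=> x l x' y y' /ext_has[i [/mi li [Ex El Ex']]] /ext_has[j [/mi lj [Ey El' Ey']]].
  have := foldl_fixed (fun B => below_trans_step B i)
    (foldl_fixed below_trans_loop E2 li) lj.
  by rewrite /trans_step Ex El Ex' Ey El' Ey' eqxx => /fix_raise.
- move=> x y /spec_has[i [/mi li Ex Ey]].
  have := foldl_fixed below_spec_step E3 li.
  by rewrite /spec_step Ex Ey => /fix_raise.
Qed.

(** The cap itself grows with the value. This monotonicity is why one maximal stage per pair is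
    enough. *)
Lemma inc_mono u v : u <= v -> inc u <= inc v.
Proof.
rewrite /incv => uv; case: (u =P 0) => [//|u0]; case: (v =P 0) => [v0|_]; first lia.
by case: (leqP u k1.+1); case: (leqP v k1.+1); lia.
Qed.

Lemma iter_inc_mono k u v : u <= v -> iter k inc u <= iter k inc v.
Proof. by move=> uv; elim: k => //= k; exact: inc_mono. Qed.

(** Two runs with equal observations are interleaved: an unobservable transition of either is played
    against an idle move of the other, and observable ones are played together. Either run may
    advance alone, hence the induction on the total length. *)
Lemma run_pair_value A : rnd A = A -> forall s1 s2 x y x' y',
  fsa_run x s1 x' -> fsa_run y s2 y' -> labs s1 = labs s2 ->
  iter (size (labs s1)) inc (A (cell x y)) <= A (cell x' y').
Proof.
move=> /round_fixed[_ tr _] s1 s2.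
have [k] := ubnP (size s1 + size s2); elim: k s1 s2 => // k IH s1 s2 lk x y x' y'.
have idle z : ext z 0 z by right.
have eps z t z' : (z, t, z') \in trans S -> lab t = None -> ext z 0 z'.
  by move=> zt lt; left; exists t; rewrite // /lab_code lt.
case: s1 lk => [|t1 s1] lk; last case E1: (lab t1) => [a|].
- case: s2 lk => [|t2 s2] /= lk; first by move=> -> ->.
  move=> xx [z yz rz] /=; case E2: (lab t2) => [a|] //= ls.
  have := tr _ _ _ _ _ (idle x) (eps _ _ _ yz E2) => /= le.
  apply: leq_trans le _; apply: (IH [::] s2) => //; lia.
- case: s2 lk => [|t2 s2] lk /=; first by rewrite E1.
  move=> [z xz rz] [u yu ru]; case E2: (lab t2) => [b|] /=; rewrite E1 /=.
    move=> [ab ls]; have := tr x (lab_code t1) z y u.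
    rewrite -iterS iterSr => le.
    apply: leq_trans (IH s1 s2 _ _ _ _ _ rz ru ls); last by move: lk => /=; lia.
    apply: iter_inc_mono; have := le; rewrite /lab_code E1 /=; apply.
      by left; exists t1; rewrite // /lab_code E1.
    by left; exists t2; rewrite // /lab_code E2 ab.
  (* Here [t2] is unobservable: the second run advances while the observable [t1] waits. *)
  move=> ls; have := tr _ _ _ _ _ (idle x) (eps _ _ _ yu E2) => /= le.
  apply: leq_trans (IH (t1 :: s1) s2 _ x u x' y' _ ru _); last first.
  - by rewrite /= E1 /=.
  - by exists z.
  - by move: lk => /=; lia.
  by rewrite /= E1; apply: (iter_inc_mono (size (labs s1)).+1).
- move=> [z xz rz] ry; rewrite /= E1 /= => ls.
  have := tr _ _ _ _ _ (eps _ _ _ xz E1) (idle y) => /= le.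
  apply: leq_trans (IH s1 s2 _ z y x' y' rz ry ls); last by move: lk => /=; lia.
  exact: iter_inc_mono.
Qed.

(** Surplus observations do no harm: the cap holds the first phase at its last stage. *)
Lemma iter_inc_lo k : k1 <= k -> iter k inc 1 = k1.+1.
Proof.
have E j : iter j inc 1 = (minn j k1).+1.
  elim: j => /= [|j ->]; first lia.
  by rewrite /incv /=; case: leqP; lia.
by rewrite E => ?; lia.
Qed.

Lemma iter_inc_hi k : k2 <= k -> iter k inc k1.+2 = (k1 + k2).+2.
Proof.
have E j : iter j inc k1.+2 = (k1 + minn j k2).+2.
  elim: j => /= [|j ->]; first lia.
  by rewrite /incv /=; case: leqP; lia.
by rewrite E => ?; lia.
Qed.

(** * Reaching the fixed point *)

Lemma sum_le_sound A : sound A -> \sum_(a < n * n) A a <= n * n * (k1 + k2).+2.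
Proof.
move=> sA; have -> : n * n * (k1 + k2).+2 = \sum_(a < n * n) (k1 + k2).+2.
  by rewrite sum_nat_const card_ord.
apply: leq_sum => a _; case: (sA a) => [-> //|[x [y [_ /good_le]]]] //.
Qed.

(** A strict increase at a genuine cell would increase the sum, and elsewhere both tables are zero
    by soundness. *)
Lemma sum_below_eq A B : sound A -> sound B -> below A B ->
  \sum_(a < n * n) B a <= \sum_(a < n * n) A a -> B = A.
Proof.
move=> sA sB AB le; apply: funext => a.
case: (ltnP a (n * n)) => la; last first.
  have out C : sound C -> C a = 0.
    move=> sC; case: (sC a) => // -[x [y [E _]]].
    by move: la; rewrite E leqNgt cell_lt.
  by rewrite !out.
apply/eqP; rewrite eqn_leq AB andbT leqNgt; apply/negP => lt; move: le.
rewrite leqNgt => /negP; apply.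
rewrite (bigD1 (Ordinal la)) //= [X in _ < X](bigD1 (Ordinal la)) //=.
by rewrite -addSn leq_add //; apply: leq_sum => i _; exact: AB.
Qed.

Definition final_table := iter (n * n * (k1 + k2).+2) rnd (fun=> 0).

Lemma sound_iter k : sound (iter k rnd (fun=> 0)).
Proof. by elim: k => [a|k IH] /=; [left | exact: sound_round]. Qed.

(* Every round that is not idle increases the sum of the bounded table. *)
Lemma final_table_fixed : rnd final_table = final_table.
Proof.
have step k : rnd (iter k rnd (fun=> 0)) = iter k rnd (fun=> 0) \/
    k <= \sum_(a < n * n) iter k rnd (fun=> 0) a.
  elim: k => [|k [E|IH]]; first by right.
    by left; rewrite /= !E.
  case: (leqP (\sum_(a < n * n) iter k.+1 rnd (fun=> 0) a)
              (\sum_(a < n * n) iter k rnd (fun=> 0) a)) => le.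
    left; have E : iter k.+1 rnd (fun=> 0) = iter k rnd (fun=> 0).
      by apply: sum_below_eq le; try exact: sound_iter; exact: below_round.
    by rewrite {1}E -iterS.
  by right; exact: leq_ltn_trans IH le.
(* Otherwise the sum has reached the upper bound of [sum_le_sound], and one more round cannot exceed
   it. *)
have [//|le] := step (n * n * (k1 + k2).+2).
apply: sum_below_eq (sound_round (sound_iter _)) (below_round _) _.
  exact: sound_iter.
exact: leq_trans (sum_le_sound (sound_round (sound_iter _))) le.
Qed.

(** From left to right, closure of the fixed table turns a violation into a cell at the top stage;
    conversely, soundness turns such a cell into a violation. *)
Lemma detectable_table :
  ~~ has (fun a => (k1 + k2).+1 < final_table a) (iota 0 (n * n)) <->
  star_D_detectable Xspec k1 k2.
Proof.
have sf : sound final_table := sound_iter _.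
have [fi ft fs] := round_fixed final_table_fixed.
split=> [/hasPn H w _ w1 w2 _ sw1 sw2|H].
  apply/seteqP; split=> // -[p q] [] /= [].
  move=> [x0 [x' [s1 [s2 [xi e1 e2 r1 r2]]]]] [y0 [y' [s3 [s4 [yi e3 e4 r3 r4]]]]] pq.
  have /H /negP : cell x' y' \in iota 0 (n * n) by rewrite mem_iota cell_lt.
  apply; have fx := run_pair_value final_table_fixed.
  have := fx _ _ _ _ _ _ r2 r4; rewrite e2 e4 => /(_ erefl) le2.
  have := fx _ _ _ _ _ _ r1 r3; rewrite e1 e3 => /(_ erefl) le1.
  have le0 : k1.+1 <= final_table (cell p q).
    rewrite -(iter_inc_lo sw1); apply: leq_trans le1.
    by apply: iter_inc_mono; exact: fi.
  (* A specified pair cannot rest at exactly k1 + 1, since the table is closed under [bumpv]. *)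
  have le0' : k1.+2 <= final_table (cell p q).
    by have := fs _ _ pq; rewrite /bumpv; case: eqP; lia.
  by rewrite -(iter_inc_hi sw2); apply: leq_trans le2; exact: iter_inc_mono.
apply/hasPn => a _; apply/negP => lt.
case: (sf a) => [E|[x [y [_ gv]]]]; first by rewrite E in lt.
(* First-phase values are at most k1 + 1, so the top stage leaves only the third clause of
   [good]. *)
case: gv => [E|[le _]|]; [lia | | ].
  lia.
move=> [_ [w1 [w2 [p [q [pq [x0 [y0 [xi yi rp rq]]] rx ry [sw1 sw2]]]]]]].
have lw2 : k2 <= size w2 by lia.
move: rp rq rx ry => [s1 e1 r1] [s2 e2 r2] [s3 e3 r3] [s4 e4 r4].
(* The two words concatenated serve as the observed word, of which they are trivially a prefix. *)
have L : language (w1 ++ w2).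
  exists x0, x, (s1 ++ s3); split=> //; last exact: fsa_run_cat r3.
  by rewrite /labs pmap_cat -e1 -e3.
have := H _ L w1 w2 (prefix_refl _) sw1 lw2.
move/seteqP => [/(_ (p, q)) + _]; apply; split=> //; split=> /=.
  by exists x0, x, s1, s3.
by exists y0, y, s2, s4.
Qed.

End Correctness.

(** * The decider and its running time *)

Definition decider : cmd := (read_header ;; square_states) ;; main_loops.

(* The largest iteration count of a loop is n ^ 2. *)
Definition loop_bound : {poly nat} := (('X + 2%:P) * ('X + 2%:P))%R.

(** Substituting the loop bound for the indeterminate of the syntactic cost leaves a polynomial in
    the size parameter alone. *)
Definition running_time : {poly nat} :=
  ((costp read_header + costp square_states + costp main_loops) \Po loop_bound)%R.

Theorem theorem6 :
  exists (prog : program) (p : {poly nat}),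
    forall (S : fsa) (Xspec : {set state S * state S}) (k1 k2 : nat),
      decides_within prog (instance_code Xspec k1 k2)
        p.[(fsa_size S + k1 + k2)%N]%R (star_D_detectable Xspec k1 k2).
Proof.
exists (compile 0 decider), running_time => S Xspec k1 k2.
set inp := instance_code Xspec k1 k2; set x := fsa_size S + k1 + k2.
pose M := (loop_bound.[x])%R; pose h0 := Store (fun=> 0) (fun=> 0).
have EM : M = (x + 2) * (x + 2).
  by rewrite /M /loop_bound hornerM hornerD hornerX hornerC.
have [ch th] := consts_setup Xspec k1 k2; rewrite -/inp -/h0 in ch th.
set h1 := den inp square_states _ in ch th.
have en : #|state S| <= x by rewrite /x /fsa_size; lia.
have em : #|trans S| + #|state S| <= x by rewrite /x /fsa_size; lia.
have ek : k1 + k2 <= x by rewrite /x; lia.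
have ei : #|init S| <= x by exact: leq_trans (max_card _) en.
have es : #|Xspec| <= #|state S| * #|state S|.
  by rewrite -card_prod; exact: max_card.
have en2 : #|state S| * #|state S| <= x * x by exact: leq_mul.
clearbody x.
(* The three phases are treated separately because [compile_ok] wants loop bounds that the command
   does not write: register 20 is set by the header, and register 28 by the squaring loop. *)
have placed_decider : placed (compile 0 decider) 0
    ((compile 0 read_header ++ compile (0 + csize read_header) square_states) ++
     compile (0 + csize (read_header ;; square_states)) main_loops) by move=> k _.
have [/placed_cat[p1 p2] p3] := placed_cat placed_decider.
rewrite size_cat !size_compile in p2 p3.
have R1 : runs (compile 0 decider) inp 0 read_header (costp read_header).[M]%R
    h0 (eval inp read_header h0) by exact: compile_ok.
have R2 : runs (compile 0 decider) inp (csize read_header) square_states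
    (costp square_states).[M]%R (eval inp read_header h0) h1.
  rewrite /h1 denE; apply: compile_ok => // i; rewrite inE => /eqP ->.
  have <- : sc h1 20 = sc (eval inp read_header h0) 20.
    by rewrite /h1 denE; exact: eval_sc.
  by case: ch => -[-> _ _ _ _] _; rewrite EM; nia.
have R3 : runs (compile 0 decider) inp (csize (read_header ;; square_states))
    main_loops (costp main_loops).[M]%R h1 (eval inp main_loops h1).
  apply: compile_ok => // i.
  have /allP sub : all (mem [:: 20; 22; 23; 24; 26; 28]) (bnds main_loops) by [].
  case: ch => -[E20 _ E22 E23 E24] [[_ E26 _ E28 _] _] /sub; rewrite !inE EM.
  (* The bound (x + 2) ^ 2 covers n ^ 2, hence the size of [Xspec], as well as k1 + k2 + 2 and the
     linear counts. *)
  by do ![case/orP]; move/eqP => ->; rewrite ?(E20, E22, E23, E24, E26, E28); nia.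
have [|t [r [lt Et ar]]] := runs_seq (runs_seq R1 R2) R3 (r := fun=> 0).
  by move=> k _ /=; case: ifP.
exists t; rewrite /run_for Et; split.
- by rewrite /running_time horner_comp 2!hornerD; exact: lt.
- by rewrite /halted size_compile.
have E0 : r 0 = sc (den inp main_loops h1) 0 by rewrite denE; exact: ar.
by rewrite [reg _ _]/= E0 (den_main_loops inp ch) th; exact: detectable_table.
Qed.
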